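(* Let $n$ and $m\neq 0$ be coprime integers, let $I=\langle n+m\gamma\rangle\subseteq\mathbb{Z}[\gamma]$ be the principal ideal of $\mathbb{Z}[\gamma]$ generated by $n+m\gamma$, let $p$ be a positive prime and let $(t,p)$ be a first-degree prime ideal of $\mathbb{Z}[\gamma]$ dividing $I$. If there exist first-degree prime ideals $(r,p)\subseteq\mathbb{Z}[\alpha]$ and $(s,p)\subseteq\mathbb{Z}[\beta]$ such that $r+s\equiv t\bmod p$, then $(r,p)$ divides $I_a=I\cap\mathbb{Z}[\alpha]$ and $(s,p)$ divides $I_b=I\cap\mathbb{Z}[\beta]$.
   Context: Setting: $a,b\in\mathbb{Z}$ have distinct non-trivial square-free parts, $\alpha,\beta\in\mathbb{C}$ satisfy $\alpha^2=a$, $\beta^2=b$ (so $\mathbb{Q}(\alpha)$ and $\mathbb{Q}(\beta)$ are distinct quadratic fields), and $\gamma=\alpha+\beta$, so that $\mathbb{Q}(\gamma)$ is the biquadratic field generated by $\alpha$ and $\beta$. The minimal polynomials over $\mathbb{Q}$ of $\alpha,\beta,\gamma$ are respectively $f_a(x)=x^2-a$, $f_b(x)=x^2-b$, $f_c(x)=x^4-2(a+b)x^2+(a-b)^2$. For an algebraic integer $\theta$, the norm of a non-zero ideal $\mathfrak{a}$ of $\mathbb{Z}[\theta]$ is $[\mathbb{Z}[\theta]:\mathfrak{a}]$, and a non-zero prime ideal of $\mathbb{Z}[\theta]$ is called a first-degree prime ideal if its norm is a prime integer. If $f$ is the minimal polynomial of $\theta$ and $p$ is a positive prime, the prime ideals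 of $\mathbb{Z}[\theta]$ of norm $p$ are in bijection with the pairs $(r,p)$ with $r\in\mathbb{Z}/p\mathbb{Z}$ and $f(r)\equiv 0 \bmod p$; the pair $(r,p)$ is identified with the kernel of the ring morphism $\pi_\theta:\mathbb{Z}[\theta]\to\mathbb{Z}/p\mathbb{Z}$ sending $\theta\mapsto r$. Thus ''$(r,p)$ is a first-degree prime ideal of $\mathbb{Z}[\theta]$'' means that $f(r)\equiv 0\bmod p$, and the ideal denoted is this kernel. A first-degree prime ideal $\mathfrak{p}$ divides $J$ if $J\subseteq\mathfrak{p}$. *)

(* Defs.v *)
From HB Require Import structures.
From mathcomp Require Import all_boot all_order all_algebra.
From mathcomp Require Import complex.
From mathcomp Require Import boolp classical_sets reals.

Set Implicit Arguments.
Unset Strict Implicit.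
Unset Printing Implicit Defensive.

Import Order.TTheory GRing.Theory Num.Theory.
Local Open Scope ring_scope.

(* The sign is part of the square-free part: that of -4 is -1. The definition
   forces a <> 0. *)
Definition squarefree (d : int) : Prop :=
  forall k : int, (k ^+ 2 %| d)%Z -> `|k| = 1.

Definition squarefree_part (a d : int) : Prop :=
  squarefree d /\ exists2 k : int, k != 0 & a = d * k ^+ 2.

Section ZAdjoin.
Variable C : numFieldType.
Implicit Types (theta x y : C).

Definition Zadj_pred theta : {pred C} :=
  [pred x | `[< exists q : {poly int}, (map_poly intr q).[theta] = x >]].

Lemma Zadj_subring_closed theta : subring_closed (Zadj_pred theta).
Proof.
split=> [|x y /asboolP[q <-] /asboolP[q' <-]|x y /asboolP[q <-] /asboolP[q' <-]].
- by apply/asboolP; exists 1; rewrite rmorph1 hornerE.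
- by apply/asboolP; exists (q - q'); rewrite rmorphB !hornerE.
- by apply/asboolP; exists (q * q'); rewrite rmorphM !hornerE.
Qed.

HB.instance Definition _ theta :=
  GRing.isSubringClosed.Build C (Zadj_pred theta) (Zadj_subring_closed theta).

(* The ring Z[theta]. *)
Record Zadj theta := ZAdj { Zval : C; _ : Zval \in Zadj_pred theta }.

HB.instance Definition _ theta := [isSub for @Zval theta].
HB.instance Definition _ theta := [Choice of Zadj theta by <:].
HB.instance Definition _ theta :=
  [SubChoice_isSubComNzRing of Zadj theta by <:].

Lemma Zadj_horner_subproof theta (q : {poly int}) :
  (map_poly intr q).[theta] \in Zadj_pred theta.
Proof. by apply/asboolP; exists q. Qed.

Definition Zadj_horner theta (q : {poly int}) : Zadj theta :=
  ZAdj (Zadj_horner_subproof theta q).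

Definition Zadj_gen theta : Zadj theta := Zadj_horner theta 'X.

Lemma Zadj_genE theta : Zval (Zadj_gen theta) = theta.
Proof. by rewrite /= map_polyX hornerX. Qed.

(* The minimal polynomial over Q of an algebraic integer has integer
   coefficients. *)
Definition minimal_polynomial theta (f : {poly int}) : Prop :=
  f \is monic /\
  forall q : {poly rat},
    root (map_poly ratr q) theta = (map_poly intr f %| q).

(* The pair (r, p) is a first-degree prime ideal of Z[theta]. *)
Definition first_degree_prime theta (p : nat) (r : 'F_p) : Prop :=
  exists2 f : {poly int}, minimal_polynomial theta f &
                          root (map_poly intr f) r.

Lemma minimal_polynomial_dvd theta (f q : {poly int}) :
  minimal_polynomial theta f -> (map_poly intr q).[theta] = 0 ->
  exists g : {poly int}, q = g * f.
Proof.
move=> [fm fP] q0.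
have mapE (h : {poly int}) :
    map_poly ratr (map_poly intr h : {poly rat}) = map_poly intr h :> {poly C}.
  by rewrite -map_poly_comp; apply: eq_map_poly => z /=; rewrite ratr_int.
have f0 : (map_poly intr f).[theta] = 0.
  by rewrite -mapE; apply/eqP; rewrite -[_ == _]/(root _ _) fP dvdpp.
set h := Pdiv.Ring.rmodp q f.
have qE : q = Pdiv.Ring.rdivp q f * f + h by apply: Pdiv.RingMonic.rdivp_eq.
have h0 : (map_poly intr h).[theta] = 0.
  by move: q0; rewrite qE rmorphD rmorphM !hornerE f0 mulr0 add0r.
have fh : map_poly intr f %| (map_poly intr h : {poly rat}).
  by rewrite -fP mapE; apply/eqP.
exists (Pdiv.Ring.rdivp q f); rewrite {1}qE.
have [->|hn0] := eqVneq h 0; first by rewrite addr0.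
have szi (g : {poly int}) : size (map_poly intr g : {poly rat}) = size g.
  by rewrite size_map_inj_poly ?rmorph0//; apply: intr_inj.
have := dvdp_leq _ fh; rewrite -size_poly_eq0 !szi size_poly_eq0 => /(_ hn0).
by rewrite leqNgt Pdiv.Ring.ltn_rmodp monic_neq0.
Qed.

Lemma reduction_exists theta (p : nat) (r : 'F_p) :
  first_degree_prime theta r ->
  exists pi : {rmorphism Zadj theta -> 'F_p}, pi (Zadj_gen theta) = r.
Proof.
move=> [f fmin fr].
have repP (x : Zadj theta) :
    {q : {poly int} | (map_poly intr q).[theta] = Zval x}.
  by apply: cid; case: x => x /= /asboolP.
pose phi (x : Zadj theta) : 'F_p := (map_poly intr (sval (repP x))).[r].
have phiE (q : {poly int}) (x : Zadj theta) :
    (map_poly intr q).[theta] = Zval x -> phi x = (map_poly intr q).[r].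
  move=> qx; rewrite /phi; case: (repP x) => q' /= q'x.
  have /(minimal_polynomial_dvd fmin)[g gE] :
    (map_poly intr (q' - q)).[theta] = 0 by rewrite rmorphB !hornerE qx q'x subrr.
  have /(congr1 (fun h => (map_poly (intr : int -> 'F_p) h).[r])) := gE.
  rewrite rmorphB rmorphM !hornerE (eqP fr) mulr0 => /eqP.
  by rewrite subr_eq0 => /eqP.
have phiB : zmod_morphism phi.
  move=> x y; case: (repP x) (repP y) => q qx [q' q'y].
  rewrite (phiE _ _ qx) (phiE _ _ q'y) (phiE (q - q')) ?rmorphB ?hornerE //=.
  by rewrite qx q'y.
have phiM : monoid_morphism phi.
  split=> [|x y].
    by rewrite (phiE 1) ?rmorph1 ?hornerE.
  case: (repP x) (repP y) => q qx [q' q'y].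
  rewrite (phiE _ _ qx) (phiE _ _ q'y) (phiE (q * q')) ?rmorphM ?hornerE //=.
  by rewrite qx q'y.
pose phiA := GRing.isZmodMorphism.Build _ _ phi phiB.
pose phiR := GRing.isMonoidMorphism.Build _ _ phi phiM.
pose pi : {rmorphism Zadj theta -> 'F_p} := HB.pack phi phiA phiR.
exists pi; rewrite [LHS](phiE 'X) ?map_polyX ?hornerX//.
by rewrite Zadj_genE.
Qed.

Lemma reduction_unique theta (p : nat)
    (pi pi' : {rmorphism Zadj theta -> 'F_p}) :
  pi (Zadj_gen theta) = pi' (Zadj_gen theta) -> pi =1 pi'.
Proof.
move=> eqg x.
have [q ->] : exists q : {poly int},
    x = (map_poly intr q).[Zadj_gen theta].
  case: x => x xP; move/asboolP: (xP) => [q qx]; exists q; apply: val_inj.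
  rewrite -horner_map -map_poly_comp /= map_polyX hornerX -qx.
  congr (_.[_]); apply: eq_map_poly => z; symmetry.
  exact: (rmorph_int (val : {rmorphism Zadj theta -> C})).
rewrite -!horner_map eqg -!map_poly_comp; congr (_.[_]).
by apply: eq_map_poly => z /=; rewrite !rmorph_int.
Qed.

(* The ideal denoted by (r, p): the kernel of the ring morphism
   Z[theta] -> Z/pZ mapping theta to r. This morphism exists and is unique when
   first_degree_prime theta r, see reduction_exists and reduction_unique. *)
Definition first_degree_ideal theta (p : nat) (r : 'F_p) : set (Zadj theta) :=
  [set x | exists2 pi : {rmorphism Zadj theta -> 'F_p},
             pi (Zadj_gen theta) = r & pi x = 0]%classic.

Definition principal_ideal theta (x : Zadj theta) : set (Zadj theta) :=
  [set x * y | y in [set: Zadj theta]]%classic.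

(* J :&: Z[eta] for J included in Z[theta], the intersection being taken in C. *)
Definition restrict_to theta eta (J : set (Zadj theta)) : set (Zadj eta) :=
  (@Zval eta @^-1` (@Zval theta @` J))%classic.

Definition ideal_divides theta (P J : set (Zadj theta)) : Prop :=
  (J `<=` P)%classic.

End ZAdjoin.

Arguments Zadj_horner {C} theta q.
Arguments Zadj_gen {C} theta.
Arguments first_degree_prime {C} theta {p} r.
Arguments first_degree_ideal {C} theta {p} r _.
Arguments restrict_to {C theta} eta J _.

(* Main.v *)
Require Import Defs.
From mathcomp Require Import all_boot all_order all_algebra.
From mathcomp Require Import complex.
From mathcomp Require Import boolp classical_sets reals.
From mathcomp Require Import ring.

(** The point is that [Z[gamma]] lies in [Z[alpha, beta]], and that the pair
    [(r, s)] defines a ring morphism [Phi] from [Z[alpha, beta]] to [Z/pZ] with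
    [alpha |-> r] and [beta |-> s]. Since [r + s = t], [Phi] sends [gamma] to
    [t], so it extends the reduction of [Z[gamma]] at [(t, p)]; it also extends
    the reductions of [Z[alpha]] at [(r, p)] and of [Z[beta]] at [(s, p)]. That
    [(t, p)] divides [I] says [n + m t = 0]. An element [z] of [I] inside
    [Z[alpha]] is [(n + m gamma) w] with [w] in [Z[gamma]], hence
    [Phi z = (n + m t) Phi w = 0], so [z] lies in [(r, p)]. Exchanging [alpha]
    and [beta] gives the other half.

    The map [Phi] is well defined because [1, alpha, beta, alpha beta] are
    linearly independent over the integers ([biquadratic_free]), which rests
    on the fact that the ratio of two distinct square-free integers is never
    the square of a rational ([squarefree_ratio_square]). Rather than building [Phi], the proof
    uses that a polynomial expression in [x + y], where [x ^ 2 = a] and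
    [y ^ 2 = b], has integer coordinates on [1, x, y, x y] that do not depend
    on the ring ([sum_sqrt_normal_form]): independence compares the coordinates
    in the complex numbers, and the resulting integer equalities are then read
    in [Z/pZ]. *)

Import Order.TTheory GRing.Theory Num.Theory.
Local Open Scope ring_scope.
Local Open Scope complex_scope.

(** After dividing [x] and [y] by their gcd, [x ^ 2] is coprime to [y ^ 2] and
    therefore divides [e]; likewise [y ^ 2] divides [d]. Square-freeness makes
    both squares equal to 1. *)
Lemma squarefree_ratio_square (d e x y : int) :
  squarefree d -> squarefree e -> x != 0 -> d * x ^+ 2 = e * y ^+ 2 -> d = e.
Proof.
move=> sqd sqe x0 dxey.
have g0 : gcdz x y != 0 by rewrite gcdz_eq0 negb_and x0.
have [x' xE] : exists x', x = x' * gcdz x y.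
  by apply/dvdzP; rewrite dvdz_gcdl.
have [y' yE] : exists y', y = y' * gcdz x y.
  by apply/dvdzP; rewrite dvdz_gcdr.
have cop : coprimez x' y'.
  rewrite coprimezE /coprime -(eqn_pmul2r (m := `|gcdz x y|%N)) ?absz_gt0//.
  by rewrite mul1n muln_gcdl -!abszM -xE -yE.
have {}dxey : d * x' ^+ 2 = e * y' ^+ 2.
  apply: (mulIf (expf_neq0 2 g0)).
  by rewrite /= -[LHS]mulrA -[RHS]mulrA -!exprMn -xE -yE.
have x1 : `|x'| = 1.
  apply: sqe; rewrite -(@Gauss_dvdzl _ _ (y' ^+ 2)).
    by rewrite -dxey dvdz_mull.
  by rewrite coprimezXl // coprimezXr.
have y1 : `|y'| = 1.
  apply: sqd; rewrite -(@Gauss_dvdzl _ _ (x' ^+ 2)).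
    by rewrite dxey dvdz_mull.
  by rewrite coprimezXl // coprimezXr // coprimez_sym.
move: dxey; rewrite -(real_normK (num_real x')) -(real_normK (num_real y')).
by rewrite x1 y1 !mulr1.
Qed.

Lemma squarefree1 : squarefree 1.
Proof.
move=> k; rewrite dvdz1 abszX -mulnn muln_eq1 => /andP[/eqP k1 _].
by rewrite -abszE k1.
Qed.

Lemma squarefree_part1 : squarefree_part 1 1.
Proof. by split; [exact: squarefree1|exists 1; rewrite ?expr1n ?mulr1]. Qed.

Lemma squarefree_part_ratio (a b d e x y : int) :
  squarefree_part a d -> squarefree_part b e -> d <> e ->
  a * x ^+ 2 = b * y ^+ 2 -> x = 0.
Proof.
move=> [sqd [k k0 ->]] [sqe [l l0 ->]] de.
rewrite -[LHS]mulrA -[RHS]mulrA -!exprMn => kxly.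
apply/eqP; apply: contra_notT de => x0.
by apply: squarefree_ratio_square kxly => //; rewrite mulf_neq0.
Qed.

Lemma quadratic_free (C : numFieldType) (a d : int) (alpha : C) :
  squarefree_part a d -> d <> 1 -> alpha ^+ 2 = a%:~R ->
  forall u v : int, u%:~R + v%:~R * alpha = 0 -> u = 0 /\ v = 0.
Proof.
move=> ad d1 alphaE u v /eqP; rewrite addr_eq0 => /eqP uv.
have v0 : v = 0.
  apply: (squarefree_part_ratio a 1 d 1 v u ad squarefree_part1 d1).
  apply: (intr_inj (R := C)).
  by rewrite mul1r rmorphM !rmorphXn /= uv sqrrN exprMn alphaE mulrC.
split=> //; apply: (intr_inj (R := C)).
by rewrite uv v0 mul0r oppr0.
Qed.

(** Multiplying the relation by the conjugate [v0 - v1 alpha] writes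
    [N beta] as [P + Q alpha], where [N] is the norm of [v0 + v1 alpha].
    Squaring forces [P Q = 0], so that [b N ^ 2] is [P ^ 2] or [a Q ^ 2]; either
    way [N = 0]. *)
Lemma biquadratic_free (C : numFieldType) (a b a0 b0 : int) (alpha beta : C) :
  squarefree_part a a0 -> squarefree_part b b0 ->
  a0 <> 1 -> b0 <> 1 -> a0 <> b0 ->
  alpha ^+ 2 = a%:~R -> beta ^+ 2 = b%:~R ->
  forall u0 u1 v0 v1 : int,
    u0%:~R + u1%:~R * alpha + v0%:~R * beta + v1%:~R * (alpha * beta) = 0 ->
    [/\ u0 = 0, u1 = 0, v0 = 0 & v1 = 0].
Proof.
move=> ha hb ha1 hb1 hab halpha hbeta u0 u1 v0 v1 rel.
have freea := quadratic_free C a a0 alpha ha ha1 halpha.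
pose N := v0 ^+ 2 - a * v1 ^+ 2.
pose P := a * (u1 * v1) - u0 * v0.
pose Q := u0 * v1 - u1 * v0.
have NPQ : N%:~R * beta = P%:~R + Q%:~R * alpha.
  apply/eqP; rewrite -subr_eq0; apply/eqP.
  transitivity ((u0%:~R + u1%:~R * alpha + v0%:~R * beta
     + v1%:~R * (alpha * beta)) * (v0%:~R - v1%:~R * alpha)); last first.
    by rewrite rel mul0r.
  rewrite /N /P /Q; ring: halpha.
have [/eqP PQ1 PQ2] : P ^+ 2 + a * Q ^+ 2 - b * N ^+ 2 = 0 /\ 2 * (P * Q) = 0.
  apply: freea; have := congr1 (fun z => z ^+ 2) NPQ.
  move=> /eqP; rewrite eq_sym -subr_eq0 => /eqP sq.
  rewrite -[RHS]sq; ring: halpha hbeta.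
move: PQ1; rewrite subr_eq0 => /eqP PQ1.
have N0 : N = 0.
  move/eqP: PQ2; rewrite mulf_eq0 /= mulf_eq0 => /orP[/eqP P0|/eqP Q0].
    apply: (squarefree_part_ratio b a b0 a0 N Q hb ha); first by move/esym.
    by rewrite -PQ1 P0 expr0n add0r.
  apply: (squarefree_part_ratio b 1 b0 1 N P hb squarefree_part1 hb1).
  by rewrite -PQ1 Q0 expr0n mulr0 addr0 mul1r.
have v10 : v1 = 0.
  apply: (squarefree_part_ratio a 1 a0 1 v1 v0 ha squarefree_part1 ha1).
  by rewrite mul1r; apply/esym/eqP; rewrite -subr_eq0 -/N N0.
have v00 : v0 = 0.
  by move/eqP: N0; rewrite /N v10 expr0n mulr0 subr0 sqrf_eq0 => /eqP.
have [] := freea u0 u1; last by [].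
by rewrite -[RHS]rel v00 v10 !mul0r !addr0.
Qed.

(** The coordinates are chosen before the ring, so the same integers serve in
    characteristic zero and modulo [p]. *)
Lemma sqrt_normal_form (a : int) (q : {poly int}) :
  exists u v : int, forall (S : comNzRingType) (x : S),
    x ^+ 2 = a%:~R -> (map_poly intr q).[x] = u%:~R + v%:~R * x.
Proof.
elim/poly_ind: q => [|q c [u [v qE]]].
  by exists 0, 0 => S x _; rewrite rmorph0 horner0 mul0r addr0.
exists (a * v + c), u => S x xE.
rewrite rmorphD rmorphM /= map_polyX map_polyC /= hornerMXaddC qE //.
ring: xE.
Qed.

Lemma sum_sqrt_normal_form (a b : int) (q : {poly int}) :
  exists u0 u1 v0 v1 : int, forall (S : comNzRingType) (x y : S),
    x ^+ 2 = a%:~R -> y ^+ 2 = b%:~R ->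
    (map_poly intr q).[x + y] =
      u0%:~R + u1%:~R * x + v0%:~R * y + v1%:~R * (x * y).
Proof.
elim/poly_ind: q => [|q c [u0 [u1 [v0 [v1 qE]]]]].
  by exists 0, 0, 0, 0 => S x y _ _; rewrite rmorph0 horner0 !mul0r !addr0.
exists (a * u1 + b * v0 + c), (u0 + b * v1), (u0 + a * v1), (u1 + v0).
move=> S x y xE yE.
rewrite rmorphD rmorphM /= map_polyX map_polyC /= hornerMXaddC (qE _ _ _ xE yE).
ring: xE yE.
Qed.

(** An integer polynomial relation between [alpha] and [alpha + beta] survives
    when [(alpha, beta)] is replaced by any square roots [(x, y)] of [a] and
    [b]: this is the well-definedness of the morphism [alpha |-> x],
    [beta |-> y] on [Z[alpha, beta]]. *)
Lemma biquadratic_transfer (C : numFieldType) (a b a0 b0 : int)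
    (alpha beta : C) :
  squarefree_part a a0 -> squarefree_part b b0 ->
  a0 <> 1 -> b0 <> 1 -> a0 <> b0 ->
  alpha ^+ 2 = a%:~R -> beta ^+ 2 = b%:~R ->
  forall f g : {poly int},
    (map_poly intr f).[alpha] = (map_poly intr g).[alpha + beta] ->
    forall (S : comNzRingType) (x y : S),
      x ^+ 2 = a%:~R -> y ^+ 2 = b%:~R ->
      (map_poly intr f).[x] = (map_poly intr g).[x + y].
Proof.
move=> ha hb ha1 hb1 hab halpha hbeta f g fg S x y xE yE.
have [u [v fE]] := sqrt_normal_form a f.
have [u0 [u1 [v0 [v1 gE]]]] := sum_sqrt_normal_form a b g.
rewrite (fE _ _ xE) (gE _ _ _ xE yE).
move: fg; rewrite (fE _ _ halpha) (gE _ _ _ halpha hbeta) => /esym/eqP.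
rewrite -subr_eq0 => /eqP fg.
have [|] := biquadratic_free C a b a0 b0 alpha beta ha hb ha1 hb1 hab halpha
  hbeta (u0 - u) (u1 - v) v0 v1.
  by rewrite -[RHS]fg; ring.
move=> /eqP; rewrite subr_eq0 => /eqP -> /eqP; rewrite subr_eq0 => /eqP -> -> ->.
by rewrite !mul0r !addr0.
Qed.

Lemma rmorph_Zadj_horner (C : numFieldType) (theta : C) (S : comNzRingType)
    (pi : {rmorphism Zadj theta -> S}) (q : {poly int}) :
  pi (Zadj_horner theta q) = (map_poly intr q).[pi (Zadj_gen theta)].
Proof.
have -> : Zadj_horner theta q = (map_poly intr q).[Zadj_gen theta].
  apply: val_inj; rewrite -horner_map -map_poly_comp /= map_polyX hornerX.
  congr (_.[_]); apply: eq_map_poly => z; symmetry.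
  exact: (rmorph_int (val : {rmorphism Zadj theta -> C})).
rewrite -horner_map -map_poly_comp; congr (_.[_]).
by apply: eq_map_poly => z /=; rewrite rmorph_int.
Qed.

Lemma Zadj_hornerP (C : numFieldType) (theta : C) (z : Zadj theta) :
  exists q : {poly int}, z = Zadj_horner theta q.
Proof.
by case: z => z zP; move/asboolP: (zP) => [q qz]; exists q; apply: val_inj.
Qed.

(** The reduction at [(r, p)] maps [theta ^ 2] to [r ^ 2], so [r] is a root of
    [X ^ 2 - a] even without knowing the minimal polynomial of [theta]. *)
Lemma first_degree_prime_sqr (C : numFieldType) (theta : C) (a : int) (p : nat)
    (r : 'F_p) :
  theta ^+ 2 = a%:~R -> first_degree_prime theta r -> r ^+ 2 = a%:~R.
Proof.
move=> thetaE /reduction_exists[pi <-].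
rewrite -rmorphXn -(rmorph_int pi); congr (pi _); apply: val_inj.
rewrite (rmorph_int (val : {rmorphism Zadj theta -> C})).
rewrite (rmorphXn (val : {rmorphism Zadj theta -> C})) /=.
by rewrite map_polyX hornerX.
Qed.

(** Evaluate [f (alpha) = (n + m gamma) q (gamma)], which says that an element
    of [Z[alpha]] lies in [I], at [(r, s)] instead of [(alpha, beta)]: the right
    side becomes [(n + m t) q (t) = 0]. The element [gamma] is kept separate from
    [alpha + beta] because its ring [Zadj gamma] is a dependent type: the
    other half is the same lemma with [gamma = beta + alpha]. *)
Lemma first_degree_ideal_restrict (C : numFieldType) (a b a0 b0 : int)
    (alpha beta gamma : C) (n m : int) (p : nat) (t r s : 'F_p) :
  squarefree_part a a0 -> squarefree_part b b0 ->
  a0 <> 1 -> b0 <> 1 -> a0 <> b0 ->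
  alpha ^+ 2 = a%:~R -> beta ^+ 2 = b%:~R -> gamma = alpha + beta ->
  let I := principal_ideal (n%:~R + m%:~R * Zadj_gen gamma) in
  ideal_divides (first_degree_ideal gamma t) I ->
  first_degree_prime alpha r -> first_degree_prime beta s -> r + s = t ->
  ideal_divides (first_degree_ideal alpha r) (restrict_to alpha I).
Proof.
move=> ha hb ha1 hb1 hab halpha hbeta gammaE I tI hr hs rst.
have nmt : n%:~R + m%:~R * t = 0 :> 'F_p.
  have [|pi <-] := tI (n%:~R + m%:~R * Zadj_gen gamma).
    by exists 1 => //; rewrite mulr1.
  by rewrite rmorphD rmorphM !rmorph_int.
move=> z [_ [w _ <-]].
have [f ->] := Zadj_hornerP C alpha z; have [q ->] := Zadj_hornerP C gamma w.
rewrite -[Zval (_ * _)]/(\val (_ * _)).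
rewrite (rmorphM (val : {rmorphism Zadj gamma -> C})) rmorphD rmorphM
  !rmorph_int /= map_polyX hornerX => fq.
have [pi pir] := reduction_exists hr; exists pi => //.
rewrite rmorph_Zadj_horner pir.
have nmE (S : comNzRingType) (x : S) :
    (map_poly intr ((n%:P + m%:P * 'X) * q)).[x] =
    (n%:~R + m%:~R * x) * (map_poly intr q).[x].
  by rewrite rmorphM rmorphD rmorphM /= !map_polyC map_polyX !hornerE.
rewrite (biquadratic_transfer C a b a0 b0 alpha beta ha hb ha1 hb1 hab halpha
  hbeta f ((n%:P + m%:P * 'X) * q) _ _ r s); last 2 first.
- exact: first_degree_prime_sqr hr.
- exact: first_degree_prime_sqr hs.
- by rewrite nmE rst nmt mul0r.
- by rewrite nmE -gammaE.
Qed.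

Theorem theorem4p3 (R : realType) (a b a0 b0 : int) (alpha beta : R[i])
    (ha : squarefree_part a a0) (hb : squarefree_part b b0)
    (ha1 : a0 <> 1) (hb1 : b0 <> 1) (hab : a0 <> b0)
    (halpha : alpha ^+ 2 = a%:~R) (hbeta : beta ^+ 2 = b%:~R)
    (n m : int) (hm : m <> 0) (hnm : coprimez n m)
    (p : nat) (hp : prime p) (t : 'F_p) :
  let gamma : R[i] := alpha + beta in
  let I := principal_ideal (n%:~R + m%:~R * Zadj_gen gamma) in
  first_degree_prime gamma t ->
  ideal_divides (first_degree_ideal gamma t) I ->
  forall r s : 'F_p,
    first_degree_prime alpha r -> first_degree_prime beta s ->
    r + s = t ->
    ideal_divides (first_degree_ideal alpha r) (restrict_to alpha I) /\
    ideal_divides (first_degree_ideal beta s) (restrict_to beta I).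
Proof.
move=> gamma I _ tI r s hr hs rst; split.
  exact: (first_degree_ideal_restrict _ a b a0 b0 alpha beta gamma n m p t r s).
apply: (first_degree_ideal_restrict _ b a b0 a0 beta alpha gamma n m p t s r)
  => //.
- by move/esym.
- exact: addrC.
- by rewrite addrC.
Qed.
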